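(* Let $L>0$ and let $(C,d)$ be either a circle of total length $L$ (i.e. $\mathbb{R}/L\mathbb{Z}$ with arc-length distance) or a compact interval of length $L$ (with the usual distance), and let $P$ be the uniform probability measure on $C$ with respect to arc-length. Then for every $n\ge1$, for the squared-distance distortion, the optimal partition of $C$ into $n$ Voronoi cells is uniform: for an optimal set of $n$-means, each Voronoi cell is an arc (respectively subinterval) of length $L/n$, each codepoint is the midpoint of its cell, and $$V_n(P)=\frac{L^2}{12\,n^2}.$$
   Context: On the circle $\mathbb{R}/L\mathbb{Z}$ the distance is $d(s,t)=\min_{k\in\mathbb{Z}}|s-t+kL|$; on an interval it is $d(s,t)=|s-t|$. Quantization: for a metric space $(M,d)$ and a Borel probability measure $P$ on $M$, the distortion of a finite nonempty set (codebook) $\alpha\subset M$ is $V(\alpha;P)=\int_M\min_{a\in\alpha}d(x,a)^2\,dP(x)$, and the $n$th quantization error is $V_n(P)=\inf\{V(\alpha;P):\alpha\subset M,\ 1\le|\alpha|\le n\}$. An optimal set of $n$-means is a set $\alpha\subset M$ with $|\alpha|\le n$ and $V(\alpha;P)=V_n(P)$; its elements are called codepoints. The Voronoi cell of $a\in\alpha$ is $\{x\in M: d(x,a)\le d(x,b)\text{ for all }b\in\alpha\}$. Here $M=C$. For $n=1$ on the circle, the single cell is the whole circle, viewed as an arc of length $L$ with the codepoint at its middle. *)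

(* Defs.v *)
From HB Require Import structures.
From mathcomp Require Import all_boot all_order all_algebra.
From mathcomp Require Import finmap all_classical all_reals all_analysis.
From mathcomp Require Import measurable_realfun ring zify.

Set Implicit Arguments.
Unset Strict Implicit.
Unset Printing Implicit Defensive.

Import Order.TTheory GRing.Theory Num.Theory.
Import numFieldTopology.Exports numFieldNormedType.Exports.

Local Open Scope classical_set_scope.
Local Open Scope ring_scope.

(* [g_sigma_algebraType] is a measurableType only over a pointedType. *)
#[short(type="pointedMetricType")]
HB.structure Definition PointedMetric (K : numDomainType) :=
  {T of Pointed T & Metric K T}.

HB.instance Definition _ (R : numFieldType) := Metric.on R^o.

Definition borel (R : realType) (T : pointedMetricType R) :=
  g_sigma_algebraType (@open T).

(* The metric space is a subset [M] of the metric space [T], with the induced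
   distance, and [P] is a Borel probability measure on [T] carried by [M]. *)
Section quantization.
Context {R : realType} {T : pointedMetricType R}.
Variables (M : set T) (P : probability (borel T) R).

Definition codebook (n : nat) (alpha : {fset T}) : Prop :=
  [/\ [set` alpha] `<=` M, (1 <= #|` alpha|)%N & (#|` alpha| <= n)%N].

Definition distortion (alpha : {fset T}) : \bar R :=
  (\int[P]_(x in M)
     \big[Order.min/+oo]_(a <- alpha) (mdist x a ^+ 2)%:E)%E.

Definition quantization_error (n : nat) : \bar R :=
  ereal_inf [set distortion alpha | alpha in codebook n].

Definition optimal_means (n : nat) (alpha : {fset T}) : Prop :=
  codebook n alpha /\ distortion alpha = quantization_error n.

Definition voronoi_cell (alpha : {fset T}) (a : T) : set T :=
  [set x | M x /\ forall b, b \in alpha -> mdist x a <= mdist x b].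

End quantization.

(* [gamma] is a parametrisation by arc-length. For a circle of length [L] the
   arc has length [l] as long as [l <= L]; for [l = L] it is the whole circle,
   cut open at the point opposite to [a]. *)
Definition arc_with_midpoint (R : realType) (T : Type) (gamma : R -> T)
    (l : R) (A : set T) (a : T) : Prop :=
  exists u : R, A = gamma @` `[u, u + l] /\ a = gamma (u + l / 2).

Section circle.
Context {R : realType}.

Definition multiples (L : R) : {pred R} := fun x => `[< exists k : int, x = k%:~R * L >].

Fact multiples_zmod_closed L : zmod_closed (multiples L).
Proof.
split=> [|x y]; rewrite /in_mem/=; first by apply/asboolP; exists 0; rewrite mul0r.
move=> /asboolP[k ->] /asboolP[m ->]; apply/asboolP; exists (k - m).
by rewrite intrB mulrBl.
Qed.

HB.instance Definition _ L :=
  GRing.isZmodClosed.Build R (multiples L) (multiples_zmod_closed L).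

Variable L : {posnum R}.

Definition circle := Quotient.quot (multiples L%:num).

HB.instance Definition _ := EqQuotient.on circle.
HB.instance Definition _ := GRing.Zmodule.on circle.
HB.instance Definition _ := isPointed.Build circle 0.

Definition circle_proj (x : R) : circle := (\pi x)%qT.

(* The infimum over [k] is attained, hence a minimum; by [circle_distE] it does
   not depend on the representatives. *)
Definition circle_dist (s t : circle) : R :=
  inf [set `|repr s - repr t + k%:~R * L%:num| | k in [set: int]].

Lemma circle_proj_eq x y :
  circle_proj x = circle_proj y <-> exists k : int, x - y = k%:~R * L%:num.
Proof.
have := Quotient.idealrBE (multiples L%:num) x y; rewrite {1}/in_mem/= => h.
split=> [/eqP|]; first by rewrite -h => /asboolP.
by move=> k; apply/eqP; rewrite -h; exact/asboolP.
Qed.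

Lemma reprKcircle : cancel repr circle_proj.
Proof. by move=> s; exact: reprK. Qed.

Let dset (x : R) : set R := [set `|x + k%:~R * L%:num| | k in [set: int]].

Let dset_inf x : has_inf (dset x).
Proof.
split; first by exists `|x + 0%:~R * L%:num|; exists 0.
by exists 0 => _ [k _ <-].
Qed.

Let dset_le x k : inf (dset x) <= `|x + k%:~R * L%:num|.
Proof. by apply: ge_inf; [case: (dset_inf x)|exists k]. Qed.

Let dset_shift x (k : int) : dset (x + k%:~R * L%:num) = dset x.
Proof.
apply/seteqP; split=> _ [m _ <-]; last first.
  by exists (m - k) => //; rewrite intrB mulrBl addrA addrAC addrK.
by exists (k + m) => //; rewrite intrD mulrDl addrA.
Qed.

Let dsetN x : dset (- x) = dset x.
Proof.
apply/seteqP; split=> _ [m _ <-]; exists (- m) => //;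
  by rewrite -normrN opprD -mulNr -intrN !opprK.
Qed.

Lemma circle_distE x y : circle_dist (circle_proj x) (circle_proj y) =
  inf [set `|x - y + k%:~R * L%:num| | k in [set: int]].
Proof.
have [k xk] : exists k : int, repr (circle_proj x) - x = k%:~R * L%:num.
  by apply/circle_proj_eq; rewrite reprKcircle.
have [m ym] : exists k : int, repr (circle_proj y) - y = k%:~R * L%:num.
  by apply/circle_proj_eq; rewrite reprKcircle.
rewrite -[RHS]/(inf (dset (x - y))) -(dset_shift _ (k - m)) intrB mulrBl -xk -ym.
by congr (inf (dset _)); rewrite addrACA -opprD !(addrC _ (_ - _)) !subrK.
Qed.

Fact circle_distxx s : circle_dist s s = 0.
Proof.
apply/eqP; rewrite eq_le; apply/andP; split.
  apply: le_trans (dset_le _ 0) _.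
  by rewrite subrr mul0r addr0 normr0.
by apply: lb_le_inf; [case: (dset_inf (repr s - repr s))|move=> _ [k _ <-]].
Qed.

Fact circle_dist_positivity s t : circle_dist s t = 0 -> s = t.
Proof.
move=> d0; pose x := repr s - repr t.
have small e : 0 < e -> exists k : int, `|x + k%:~R * L%:num| < e.
  move=> e0; have [_ [k _ <-]] := inf_adherent e0 (dset_inf x).
  by rewrite [inf _]d0 add0r; exists k.
have [|k kL] := small (L%:num / 2); first by rewrite divr_gt0.
have xk : x + k%:~R * L%:num = 0.
  apply/eqP; rewrite -normr_eq0 -[_ == _]negbK; apply/negP => n0.
  have [|m mx] := small `|x + k%:~R * L%:num|; first by rewrite lt_neqAle eq_sym n0/=.
  have : `|(k - m)%:~R * L%:num| < L%:num.
    have -> : (k - m)%:~R * L%:num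
      = (x + k%:~R * L%:num) - (x + m%:~R * L%:num) by rewrite intrB; ring.
    rewrite (le_lt_trans (ler_normB _ _))// [ltRHS]splitr ltrD//.
    exact: lt_trans mx kL.
  rewrite normrM (gtr0_norm (x := L%:num))// gtr_pMl// -intr_norm ltrz1.
  move=> km; have {km} km : k = m by lia.
  by move: mx; rewrite km ltxx.
rewrite -(reprKcircle s) -(reprKcircle t); apply/circle_proj_eq.
by exists (- k); apply/eqP; rewrite intrN mulNr -addr_eq0 -/x xk.
Qed.

Fact circle_dist_sym s t : circle_dist s t = circle_dist t s.
Proof. by rewrite /circle_dist -[LHS]/(inf (dset _)) -dsetN opprB. Qed.

Fact circle_dist_triangle t s r :
  circle_dist s r <= circle_dist s t + circle_dist t r.
Proof.
apply/ler_addgt0Pl => e e0.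
have e2 : 0 < e / 2 by rewrite divr_gt0.
have [_ [k _ <-] ks] := inf_adherent e2 (dset_inf (repr s - repr t)).
have [_ [m _ <-] mt] := inf_adherent e2 (dset_inf (repr t - repr r)).
apply: le_trans (dset_le _ (k + m)) _.
have -> : repr s - repr r + (k + m)%:~R * L%:num =
    (repr s - repr t + k%:~R * L%:num) + (repr t - repr r + m%:~R * L%:num).
  by rewrite intrD; ring.
rewrite (le_trans (ler_normD _ _))// (le_trans (ltW (ltrD ks mt)))//.
by rewrite addrACA -splitr addrC.
Qed.

HB.instance Definition _ := isMetric.Build R circle
  circle_distxx circle_dist_positivity circle_dist_sym circle_dist_triangle.

Lemma circle_proj_dist x y : mdist (circle_proj x) (circle_proj y) <= `|x - y|.
Proof.
rewrite [leLHS]circle_distE; apply: le_trans (dset_le _ 0) _.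
by rewrite mul0r addr0.
Qed.

End circle.

(* Continuous functions on the line are Borel; [measurableTypeR R] is the line
   with the sigma-algebra on which the library defines [lebesgue_measure]. *)
Lemma measurable_borel (R : realType) (T : pointedMetricType R) (f : R -> T) :
  continuous f ->
  measurable_fun setT (f : measurableTypeR R -> borel T).
Proof.
move=> /continuousP cf.
apply: (@measurability _ _ (measurableTypeR R) (borel T) _ _ (@open T)) => //.
by move=> _ [B oB <-]; rewrite setTI; apply: open_measurable; exact: cf.
Qed.

Section uniform_circle.
Context {R : realType} (L : {posnum R}).

Lemma circle_proj_continuous : continuous (@circle_proj R L).
Proof.
move=> x A /nbhs_ballP[e /= e0 eA]; apply/nbhs_ballP; exists e => //= y xy.
apply: eA; rewrite ballEmdist/=; exact: le_lt_trans (circle_proj_dist L x y) xy.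
Qed.

Definition circle_proj_borel : measurableTypeR R -> borel (circle L) :=
  circle_proj L.

HB.instance Definition _ := isMeasurableFun.Build _ _ _ _ circle_proj_borel
  (measurable_borel circle_proj_continuous).

(* The image of the uniform distribution on [0, L] under R -> R / L Z. *)
Definition circle_uniform : probability (borel (circle L)) R :=
  distribution (uniform_prob (gt0 L)) circle_proj_borel.

End uniform_circle.

Section uniform_interval.
Context {R : realType} (a b : R) (ab : a < b).

Definition line_id : measurableTypeR R -> borel R^o := idfun.

HB.instance Definition _ := isMeasurableFun.Build _ _ _ _ line_id
  (@measurable_borel R R^o idfun (fun=> cvg_id)).

Definition interval_uniform : probability (borel R^o) R :=
  distribution (uniform_prob ab) line_id.

End uniform_interval.

(* Main.v *)
(* Put [r = L / 2n] and [(r^2 - t^2)^+ =: cap r t]. For every codebook [alpha],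
     min_a d(x, a)^2 >= r^2 - \sum_a cap r (d(x, a))
   pointwise, since a sum of nonnegative terms dominates the largest one. Each
   cap has integral at most [4/3 r^3], so for at most [n] codepoints the
   distortion is at least [r^2 - n/L * 4/3 r^3 = r^2/3 = L^2 / (12 n^2)].
   In case of equality there are exactly [n] codepoints, every cap lies inside
   the space, and by continuity the pointwise inequality is an equality
   everywhere. The latter says that the open balls of radius [r] around the
   codepoints are disjoint and the closed ones cover; since midpoints exist,
   codepoints are then at distance at least [2r], whence the Voronoi cells are
   the closed balls of radius [r]. *)
Require Import Defs.
From HB Require Import structures.
From mathcomp Require Import all_boot all_order all_algebra.
From mathcomp Require Import finmap all_classical all_reals all_analysis.
From mathcomp Require Import measurable_realfun ring lra zify.

Set Implicit Arguments.
Unset Strict Implicit.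
Unset Printing Implicit Defensive.

Import Order.TTheory GRing.Theory Num.Theory.
Import numFieldTopology.Exports numFieldNormedType.Exports.

Local Open Scope classical_set_scope.
Local Open Scope ring_scope.

(** * Integrals over segments, and the truncated parabola [cap] *)

Section integration.
Context {R : realType}.
Notation mu := (@lebesgue_measure R).
Implicit Types (f g : R -> R) (u v c r : R).

Lemma continuous_integrable f u v : continuous f ->
  mu.-integrable `[u, v] (EFin \o f).
Proof.
move=> cf; apply: continuous_compact_integrable; first exact: segment_compact.
exact: continuous_subspaceT.
Qed.

Lemma Rintegral_itv_sum (I : Type) (s : seq I) (F : I -> R -> R) u v :
  (forall i, continuous (F i)) ->
  continuous (fun x => \sum_(i <- s) F i x) /\
  \int[mu]_(x in `[u, v]) (\sum_(i <- s) F i x) =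
    \sum_(i <- s) \int[mu]_(x in `[u, v]) F i x.
Proof.
move=> cF; elim: s => [|i s [cs IH]].
  split; first by under eq_fun do rewrite big_nil; exact: cst_continuous.
  rewrite big_nil; under eq_Rintegral do rewrite big_nil.
  by rewrite Rintegral_cst// mul0r.
have E x : \sum_(j <- i :: s) F j x = F i x + \sum_(j <- s) F j x.
  by rewrite big_cons.
split; first by under eq_fun do rewrite E; move=> x; apply: cvgD; [exact: cF|exact: cs].
rewrite big_cons; under eq_Rintegral do rewrite E.
by rewrite RintegralD ?IH//; exact: continuous_integrable.
Qed.

Lemma Rintegral_itv_cst u v r : u <= v ->
  \int[mu]_(x in `[u, v]) r = r * (v - u).
Proof.
move=> uv; rewrite Rintegral_cst//= lebesgue_measure_itv/= lte_fin.
by case: ltgtP uv => // -> _; rewrite subrr.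
Qed.

Lemma le_Rintegral_itv f s t u v : continuous f ->
  (forall x, `[u, v]%classic x -> 0 <= f x) -> `[s, t] `<=` `[u, v] ->
  \int[mu]_(x in `[s, t]) f x <= \int[mu]_(x in `[u, v]) f x.
Proof.
move=> cf f0 stuv.
rewrite fine_le//; try exact/integrable_fin_num/continuous_integrable.
apply: ge0_subset_integral => //.
by have /integrableP[] := @continuous_integrable f u v cf.
Qed.

Lemma Rintegral_itv_eq0 f u v : u < v -> continuous f ->
  (forall x, `[u, v]%classic x -> 0 <= f x) ->
  \int[mu]_(x in `[u, v]) f x = 0 ->
  forall x, `[u, v]%classic x -> f x = 0.
Proof.
move=> uv cf f0 If0 x uvx; apply/eqP; rewrite eq_le f0// andbT leNgt.
apply/negP => fx0.
have /cvgrPdist_lt/(_ (f x / 2)) := cf x.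
rewrite divr_gt0// => /(_ isT) /nbhs_ballP[d /= d0 fd].
(* Near [x], [f] exceeds [f x / 2]. Clipping to [[u, v]] leaves an interval of positive length even
   if [x] is an endpoint, and radius [d / 2] keeps it inside the open ball. *)
pose s := Num.max u (x - d / 2); pose t := Num.min v (x + d / 2).
have [ux xv] : u <= x /\ x <= v by move: uvx; rewrite /= in_itv => /andP[].
have st : s < t by rewrite /s /t gt_max !lt_min uv/=; lra.
have sub : `[s, t] `<=` `[u, v].
  by apply: subset_itvScc; rewrite bnd_simp ?le_max ?ge_min lexx.
suff : f x / 2 * (t - s) <= 0 by rewrite leNgt pmulr_rgt0 ?divr_gt0// subr_gt0 st.
rewrite -If0; apply: le_trans (le_Rintegral_itv cf f0 sub).
rewrite -(Rintegral_itv_cst (f x / 2) (ltW st)); apply: le_Rintegral => //.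
- by apply: continuous_integrable => y; exact: cvg_cst.
- exact: continuous_integrable.
move=> y; rewrite /= in_itv/= /s /t ge_max le_min => /andP[/andP[_ h1] /andP[_ h2]].
have : ball x d y by rewrite /ball/= ltr_norml; lra.
by move/fd; rewrite /= ltr_norml => /andP[_ ?]; lra.
Qed.

Definition cap r t := Num.max 0 (r ^+ 2 - t ^+ 2).

Lemma cap_ge0 r t : 0 <= cap r t.
Proof. by rewrite /cap le_max lexx. Qed.

Lemma cap_norm r t : cap r `|t| = cap r t.
Proof. by rewrite /cap real_normK ?num_real. Qed.

Lemma cap_continuous r : continuous (cap r).
Proof.
move=> t; apply: (@continuous_max R R^o (cst 0) (fun t => r ^+ 2 - t ^+ 2)).
  exact: cst_continuous.
by apply: cvgB; [exact: cvg_cst|exact: exprn_continuous].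
Qed.

(** The primitive of [cap r] vanishing at 0 (for [r > 0]): the primitive of the parabola with its
    argument clamped to [[-r, r]], since [cap r] is zero outside. *)
Definition cap_prim r t :=
  let s := Num.max (- r) (Num.min r t) in r ^+ 2 * s - s ^+ 3 / 3.

Lemma Rintegral_parabola r c u v : u <= v ->
  \int[mu]_(x in `[u, v]) (r ^+ 2 - (x - c) ^+ 2) =
  (r ^+ 2 * (v - c) - (v - c) ^+ 3 / 3) - (r ^+ 2 * (u - c) - (u - c) ^+ 3 / 3).
Proof.
rewrite le_eqVlt => /predU1P[->|uv]; first by rewrite set_itv1 Rintegral_set1 subrr.
pose F x := r ^+ 2 * (x - c) - (x - c) ^+ 3 / 3.
have dF (x : R) : is_derive x (1 : R) F (r ^+ 2 - (x - c) ^+ 2).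
  rewrite /F; apply: is_derive_eq; rewrite scaler0 /GRing.scale/=.
  by field.
have cF : continuous F.
  move=> y; apply: differentiable_continuous; apply/derivable1_diffP.
  by have [] := dF y.
rewrite /Rintegral (@continuous_FTC2 _ _ F)//.
- apply: continuous_subspaceT => x; apply: cvgB; first exact: cvg_cst.
  rewrite /=; under eq_fun do rewrite expr2.
  by apply: cvgM; apply: cvgB => //; exact: cvg_cst.
- split; first by move=> x _; have [] := dF x.
  + exact/cvg_at_right_filter/cF.
  + exact/cvg_at_left_filter/cF.
- by move=> x _; rewrite derive1E; apply/derive_val.
Qed.

(** The integrand is the parabola on [[c - r, c + r]] and 0 elsewhere, so only the intersection with
    [[u, v]] counts; clamping in [cap_prim] computes its endpoints. *)
Lemma Rintegral_cap r c u v : 0 < r -> u <= v ->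
  \int[mu]_(x in `[u, v]) cap r (x - c) =
  cap_prim r (v - c) - cap_prim r (u - c).
Proof.
move=> r0 uv.
rewrite (@eq_Rintegral _ _ _ mu _
  ((fun x => r ^+ 2 - (x - c) ^+ 2) \_ (`[c - r, c + r]))); last first.
  move=> x _; rewrite patchE /cap; case: ifPn; rewrite ?notin_setE ?inE/= in_itv/=.
    by move=> /andP[h1 h2]; apply/max_r; nra.
  move=> /negP; rewrite negb_and -!ltNge => /orP[] h; apply/max_l; nra.
rewrite -Rintegral_mkcondr.
have -> : `[u, v] `&` `[c - r, c + r] =
    `[Num.max u (c - r), Num.min v (c + r)]%classic :> set R.
  apply/seteqP; split=> x /=; rewrite !in_itv/= ge_max le_min.
    by move=> [/andP[-> ->] /andP[-> ->]].
  by move=> /andP[/andP[-> ->] /andP[-> ->]].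
rewrite /cap_prim.
have [h|h] := leP (Num.max u (c - r)) (Num.min v (c + r)).
  rewrite Rintegral_parabola//; move: h; rewrite !ge_max !le_min uv/=.
  move=> /andP[ucr /andP[vcr _]].
  have -> : Num.max (- r) (Num.min r (v - c)) = Num.min v (c + r) - c.
    by rewrite max_r; [case: leP => ?; case: leP => ?; lra|rewrite le_min; lra].
  have -> // : Num.max (- r) (Num.min r (u - c)) = Num.max u (c - r) - c.
  by rewrite min_r; [case: leP => ?; case: leP => ?; lra|lra].
rewrite set_itv_ge ?Rintegral_set0; last by rewrite bnd_simp -ltNge.
(* When the intersection is empty, both endpoints lie on the same side of the cap and clamp to the
   same value. *)
suff -> : Num.max (- r) (Num.min r (v - c)) = Num.max (- r) (Num.min r (u - c)).
  by rewrite subrr.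
have [vc|cv] := ltP v (c - r); first by rewrite !min_r ?max_l//; lra.
have cu : c + r < u by move: h; rewrite lt_max !gt_min !ltNge uv cv/=; lra.
by rewrite !min_l//; lra.
Qed.

Lemma cap_prim_le r t : 0 < r -> cap_prim r t <= 2 / 3 * r ^+ 3 ?= iff (r <= t).
Proof.
move=> r0; rewrite /cap_prim /=; set s := Num.max _ _.
have sr : - r <= s <= r.
  by rewrite /s le_max lexx/= ge_max; apply/andP; split; [lra|rewrite ge_min lexx].
(* The cubic has a double root at its maximum [s = r]; the other factor is at least [r] as
   [s >= - r]. Hence equality exactly when [s = r]. *)
have E : 2 / 3 * r ^+ 3 - (r ^+ 2 * s - s ^+ 3 / 3) = (r - s) ^+ 2 * (2 * r + s) / 3.
  by field.
have E0 : 0 <= (r - s) ^+ 2 * (2 * r + s) / 3.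
  by rewrite divr_ge0// mulr_ge0 ?sqr_ge0//; lra.
split; first by rewrite -subr_ge0 E.
rewrite eq_sym -subr_eq0 E !mulf_eq0 orbb invr_eq0 subr_eq0.
apply/idP/idP => [/orP[/orP[/eqP rs|/eqP]|/eqP]|rt]; [|lra|lra|].
  move: rs; rewrite /s; case: leP => ?; case: leP => ? => //; lra.
by rewrite /s (min_l rt) max_r ?eqxx//; lra.
Qed.

Lemma cap_primN r t : 0 < r -> cap_prim r (- t) = - cap_prim r t.
Proof.
move=> r0; rewrite /cap_prim.
have -> : Num.max (- r) (Num.min r (- t)) = - Num.max (- r) (Num.min r t).
  by case: (leP r (- t)) => ?; case: (leP r t) => ?; do ?[case: leP => ?]; lra.
by ring.
Qed.

(** Each side of [c] contributes at most [2/3 r^3], by oddness of [cap_prim]. The equality case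
    later locates optimal codepoints in an interval. *)
Lemma Rintegral_cap_le r c u v : 0 < r -> u <= v ->
  \int[mu]_(x in `[u, v]) cap r (x - c) <= 4 / 3 * r ^+ 3
    ?= iff (u <= c - r) && (c + r <= v).
Proof.
move=> r0 uv; rewrite Rintegral_cap//.
have [le1 eq1] := cap_prim_le (v - c) r0.
have [le2 eq2] := cap_prim_le (c - u) r0.
have E : cap_prim r (u - c) = - cap_prim r (c - u) by rewrite -cap_primN// opprB.
have -> : (u <= c - r) && (c + r <= v) = (r <= c - u) && (r <= v - c).
  by congr (_ && _); apply/idP/idP; lra.
rewrite E opprK -eq1 -eq2; split; first by lra.
by apply/eqP/andP => [?|[/eqP -> /eqP ->]]; [split; apply/eqP; lra|lra].
Qed.
End integration.

(** * Finite sums and minima, continuity and Borel measurability *)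

Lemma ler_sum2 (R : numDomainType) (I : eqType) (s : seq I) (F : I -> R) i j :
  uniq s -> i \in s -> j \in s -> i != j -> (forall k, 0 <= F k) ->
  F i + F j <= \sum_(k <- s) F k.
Proof.
move=> us si sj ij F0; rewrite (bigD1_seq i)//= lerD2l.
rewrite big_mkcond/= (bigD1_seq j)//= eq_sym ij lerDl.
by apply: sumr_ge0 => k _; case: ifP.
Qed.

Lemma ler_sum1 (R : numDomainType) (I : eqType) (s : seq I) (F : I -> R) i :
  uniq s -> i \in s -> (forall k, 0 <= F k) -> F i <= \sum_(k <- s) F k.
Proof.
by move=> us si F0; rewrite (bigD1_seq i)//= lerDl sumr_ge0.
Qed.

(** The neutral element [+oo] of the minimum disappears for a nonempty list, so the minimum is a
    continuous real function [m]; the last two clauses characterise [m] without the big operator. *)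
Lemma bigmin_continuous (R : realType) (T : topologicalType) (I : eqType)
    (s : seq I) (F : I -> T -> R) :
  s != [::] -> (forall i, continuous (F i)) ->
  exists m : T -> R, [/\ continuous m,
    forall t, (\big[Order.min/+oo]_(i <- s) (F i t)%:E = (m t)%:E)%E,
    forall t i, i \in s -> m t <= F i t
  & forall t, exists2 i, i \in s & m t = F i t].
Proof.
move=> + cF; elim: s => [//|i s IH] _.
have [->|/IH [m [cm mE mle mex]]] := eqVneq s [::].
  exists (F i); split => [|t|t j|t]; first exact: cF.
  - by rewrite big_seq1_id min_l// leey.
  - by rewrite inE => /eqP ->.
  - by exists i; rewrite ?mem_head.
exists (F i \min m); split => [t|t|t j|t].
- by apply: continuous_min; [exact: cF|exact: cm].
- by rewrite big_cons mE -EFin_min.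
- by rewrite inE => /predU1P[->|/(mle t) h]; rewrite /= ge_min ?lexx// h orbT.
- rewrite /=; case: leP => _; first by exists i; rewrite ?mem_head.
  by have [j js ->] := mex t; exists j => //; rewrite inE js orbT.
Qed.

Lemma mdist_continuous (R : realFieldType) (T : metricType R) (a : T) :
  continuous (mdist ^~ a : T -> R^o).
Proof.
move=> x; apply/cvgrPdist_lt => e e0; apply/nbhs_ballP; exists e => //= y.
rewrite ballEmdist/= => xy; rewrite (le_lt_trans _ xy)// ler_norml.
have := metric_triangle x y a; have := metric_triangle y x a.
by rewrite (metric_sym y x) => ? ?; apply/andP; split; lra.
Qed.

Lemma continuous_borel (R : realType) (T : pointedMetricType R) (f : T -> R) :
  continuous f -> measurable_fun setT (f : borel T -> R).
Proof.
move=> /continuousP cf; move=> mT.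
apply: (@measurability _ _ (borel T) (measurableTypeR R) setT f _
  (RGenOInfty.measurableE R)) => //.
move=> _ [_ [x ->] <-]; rewrite setTI; apply: sub_sigma_algebra.
exact/cf/rray_open.
Qed.

Lemma sumr_fset_const (V : nmodType) (I : choiceType) (A : {fset I}) (x : V) :
  \sum_(i <- A) x = x *+ #|` A|.
Proof. by rewrite big_const_seq count_predT iter_addr_0. Qed.

(** * Quantization of a space parametrised by a segment *)

Section codebooks.
Context {R : realType} {T : pointedMetricType R}.
Variables (gamma : R -> T) (p : R) (L r : R) (n : nat).
Variables (M : set T) (P : probability (borel T) R).
Notation mu := (@lebesgue_measure R).
Notation q := (p + L).
Hypotheses (n_gt0 : (0 < n)%N) (r_gt0 : 0 < r) (LE : L = 2 * n%:R * r).
(** What the circle and the interval have in common: a 1-Lipschitz parametrisation onto [M] carrying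
    the uniform law to [P], a bound on the mass of each cap, and metric midpoints. *)
Hypothesis gamma_lip : forall x y, mdist (gamma x) (gamma y) <= `|x - y|.
Hypothesis gammaM : gamma @` `[p, q] = M.
Hypothesis integralP : forall f : T -> R, continuous f -> (forall t, 0 <= f t) ->
  (\int[P]_(t in M) (f t)%:E =
   (L^-1 * \int[mu]_(x in `[p, q]) f (gamma x))%:E)%E.
Hypothesis Rintegral_cap_mdist : forall c, M c ->
  \int[mu]_(x in `[p, q]) cap r (mdist (gamma x) c) <= 4 / 3 * r ^+ 3.
Hypothesis midpoint : forall b c, M b -> M c -> exists t, [/\ M t,
  mdist t b <= mdist b c / 2 & mdist t c <= mdist b c / 2].

Let L_gt0 : 0 < L. Proof. by rewrite LE !mulr_gt0// ltr0n. Qed.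

Let pq : p < q. Proof. by rewrite ltrDl. Qed.

Let qBp : q - p = L. Proof. by rewrite addrC addKr. Qed.

Let gamma_continuous : continuous gamma.
Proof.
move=> x A /nbhs_ballP[e /= e0 eA]; apply/nbhs_ballP; exists e => //= y xy.
by apply: eA; rewrite ballEmdist/=; exact: le_lt_trans (gamma_lip x y) xy.
Qed.

Let distortion_min (alpha : {fset T}) : (0 < #|` alpha|)%N ->
  exists m : T -> R, [/\ continuous m,
    forall t a, a \in alpha -> m t <= mdist t a ^+ 2,
    forall t, exists2 a, a \in alpha & m t = mdist t a ^+ 2
  & distortion M P alpha =
      (L^-1 * \int[mu]_(x in `[p, q]) m (gamma x))%:E].
Proof.
move=> alpha0.
have s0 : (alpha : seq T) != [::] by rewrite -size_eq0 -lt0n.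
have [|m [cm mE mle mex]] := bigmin_continuous (F := fun a t => mdist t a ^+ 2) s0.
  move=> a t; apply: (@continuous_comp _ _ _ (mdist ^~ a : T -> R^o) (fun x => x ^+ 2)).
    exact: mdist_continuous.
  exact: exprn_continuous.
exists m; split => //; rewrite -integralP//; first exact: eq_integral.
by move=> t; have [a _ ->] := mex t; exact: sqr_ge0.
Qed.

Let ccap c : continuous (fun x => cap r (mdist (gamma x) c)).
Proof.
move=> x; apply: (@continuous_comp _ _ _ (fun x => mdist (gamma x) c : R^o) (cap r)).
  apply: (@continuous_comp _ _ _ gamma (mdist ^~ c : T -> R^o)).
    exact: gamma_continuous.
  exact: mdist_continuous.
exact: cap_continuous.
Qed.

Let cap_inside (t c : T) : mdist t c < r -> 0 < cap r (mdist t c).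
Proof.
move=> tc; rewrite /cap lt_max ltxx/= subr_gt0 ltr_pXn2r// nnegrE ?mdist_ge0//.
exact: ltW.
Qed.

Section lower_bound.
Variable alpha : {fset T}.
Hypotheses (alphaM : [set` alpha] `<=` M) (alpha_gt0 : (0 < #|` alpha|)%N).
Variable m : T -> R.
Hypothesis m_continuous : continuous m.
Hypothesis m_le : forall t a, a \in alpha -> m t <= mdist t a ^+ 2.
Hypothesis m_attained : forall t, exists2 a, a \in alpha & m t = mdist t a ^+ 2.

Let S t := \sum_(a <- alpha) cap r (mdist t a).

Let mS t : r ^+ 2 <= m t + S t.
Proof.
have [a aalpha ->] := m_attained t; rewrite addrC -lerBlDr.
apply: le_trans (ler_sum1 (fset_uniq alpha) aalpha _).
  by rewrite /cap le_max lexx orbT.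
by move=> k; exact: cap_ge0.
Qed.

Let cS : continuous (fun x => S (gamma x)).
Proof.
exact: (Rintegral_itv_sum alpha p q ccap).1.
Qed.

Let IS : \int[mu]_(x in `[p, q]) S (gamma x) =
  \sum_(a <- alpha) \int[mu]_(x in `[p, q]) cap r (mdist (gamma x) a).
Proof. exact: (Rintegral_itv_sum alpha p q ccap).2. Qed.

Let cm : continuous (fun x => m (gamma x)).
Proof.
move=> x; apply: (@continuous_comp _ _ _ gamma m); first exact: gamma_continuous.
exact: m_continuous.
Qed.

(** The integrated slack of the pointwise inequality [mS]: its sign gives the lower bound, its
    vanishing the equality case. *)
Let excess : \int[mu]_(x in `[p, q]) (m (gamma x) + S (gamma x) - r ^+ 2) =
  \int[mu]_(x in `[p, q]) m (gamma x) +
  \int[mu]_(x in `[p, q]) S (gamma x) - r ^+ 2 * L.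
Proof.
rewrite RintegralB//; last 2 first.
- by apply: continuous_integrable => x; apply: cvgD; [exact: cm|exact: cS].
- by apply: continuous_integrable => x; exact: cvg_cst.
rewrite RintegralD//; try exact: continuous_integrable.
by rewrite Rintegral_itv_cst ?(ltW pq)// qBp.
Qed.

Let cD : continuous (fun x => m (gamma x) + S (gamma x) - r ^+ 2).
Proof.
by move=> x; apply: cvgB; [apply: cvgD; [exact: cm|exact: cS]|exact: cvg_cst].
Qed.

Let excess_ge0 : 0 <= \int[mu]_(x in `[p, q]) (m (gamma x) + S (gamma x) - r ^+ 2).
Proof. by apply: Rintegral_ge0 => x _; rewrite subr_ge0. Qed.

Let IS_le : \int[mu]_(x in `[p, q]) S (gamma x) <= #|` alpha|%:R * (4 / 3 * r ^+ 3).
Proof.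
rewrite IS mulr_natl -sumr_fset_const [leLHS]big_seq [leRHS]big_seq.
by apply: ler_sum => a aalpha; apply: Rintegral_cap_mdist; exact: alphaM.
Qed.

Lemma lower_bound : (#|` alpha| <= n)%N ->
  r ^+ 2 / 3 <= L^-1 * \int[mu]_(x in `[p, q]) m (gamma x).
Proof.
move=> alphan; rewrite [leRHS]mulrC ler_pdivlMr//.
have := excess_ge0; rewrite excess.
have : #|` alpha|%:R * (4 / 3 * r ^+ 3) <= n%:R * (4 / 3 * r ^+ 3).
  by rewrite ler_wpM2r ?ler_nat// mulr_ge0 ?exprn_ge0// ltW.
(* In multiples of [n r^3] the claim reads [2 - 4/3 = 2/3], which is linear arithmetic. *)
have -> : r ^+ 2 * L = 2 * n%:R * r ^+ 3 by rewrite LE; ring.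
have -> : r ^+ 2 / 3 * L = 2 / 3 * n%:R * r ^+ 3 by rewrite LE; ring.
by have := IS_le; lra.
Qed.

Hypothesis alpha_le : (#|` alpha| <= n)%N.
Hypothesis optimal : L^-1 * \int[mu]_(x in `[p, q]) m (gamma x) = r ^+ 2 / 3.

Let Im : \int[mu]_(x in `[p, q]) m (gamma x) = 2 / 3 * n%:R * r ^+ 3.
Proof.
have -> : 2 / 3 * n%:R * r ^+ 3 = L * (r ^+ 2 / 3) by rewrite LE; ring.
by rewrite -optimal mulVKf// gt_eqF.
Qed.

Let IS_ge : n%:R * (4 / 3 * r ^+ 3) <= \int[mu]_(x in `[p, q]) S (gamma x).
Proof.
have := excess_ge0; rewrite excess Im.
have -> : r ^+ 2 * L = 2 * n%:R * r ^+ 3 by rewrite LE; ring.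
by lra.
Qed.

(** The total cap mass is at least [n] times and at most [#|alpha|] times the positive number
    [4/3 r^3]. *)
Lemma optimal_card : #|` alpha| = n.
Proof.
apply/eqP; rewrite eqn_leq alpha_le/= -(ler_nat R).
rewrite -(ler_pM2r (x := 4 / 3 * r ^+ 3)) ?mulr_gt0 ?exprn_gt0//.
exact: le_trans IS_ge IS_le.
Qed.

(** The deficits of the caps from [4/3 r^3] are nonnegative with sum at most 0, so each vanishes. *)
Lemma optimal_cap a : a \in alpha ->
  \int[mu]_(x in `[p, q]) cap r (mdist (gamma x) a) = 4 / 3 * r ^+ 3.
Proof.
move=> aalpha; have := IS_ge; rewrite IS -optimal_card mulr_natl -sumr_fset_const.
rewrite -subr_le0 -sumrB => sum_le0.
have F0 b : b \in alpha ->
    0 <= 4 / 3 * r ^+ 3 - \int[mu]_(x in `[p, q]) cap r (mdist (gamma x) b).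
  by move=> balpha; rewrite subr_ge0 Rintegral_cap_mdist//; exact: alphaM.
apply/eqP; rewrite eq_sym -subr_eq0 eq_le F0// andbT.
apply: le_trans sum_le0; rewrite (bigD1_seq a)//= lerDl.
rewrite big_seq_cond; apply: sumr_ge0 => b /andP[balpha _]; exact: F0.
Qed.

(** A continuous nonnegative function with zero integral vanishes everywhere on the segment, and
    [gamma] maps the segment onto [M]. *)
Lemma optimal_excess t : M t -> m t + S t = r ^+ 2.
Proof.
rewrite -gammaM => -[x pqx <-]; apply/eqP; rewrite -subr_eq0; apply/eqP.
apply: (Rintegral_itv_eq0 pq cD _ _ pqx) => [y _|]; first by rewrite subr_ge0.
apply/eqP; rewrite eq_le excess_ge0 andbT excess Im.
have -> : r ^+ 2 * L = 2 * n%:R * r ^+ 3 by rewrite LE; ring.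
by have := IS_le; rewrite optimal_card; lra.
Qed.

Lemma optimal_covers t : M t -> m t <= r ^+ 2.
Proof.
move=> /optimal_excess <-; rewrite lerDl sumr_ge0// => a _; exact: cap_ge0.
Qed.

(** If two open balls met at [t], the cap of a nearest codepoint [e] would already account for
    [r^2 - m t], and a second positive cap would push [m t + S t] above [r^2]. *)
Lemma optimal_disjoint t b c : M t -> b \in alpha -> c \in alpha ->
  mdist t b < r -> mdist t c < r -> b = c.
Proof.
move=> Mt balpha calpha tb tc; apply/eqP; rewrite -[_ == _]negbK; apply/negP => bc.
have [e ealpha me] := m_attained t.
have te : mdist t e < r.
  rewrite -(ltr_pXn2r (n := 2)) ?nnegrE ?mdist_ge0 ?(ltW r_gt0)// -me.
  apply: le_lt_trans (m_le t balpha) _.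
  by rewrite ltr_pXn2r// nnegrE ?mdist_ge0// ltW.
(* The nearest codepoint [e] may be neither [b] nor [c]; as these differ, one of them differs from
   [e]. *)
have [f [falpha ef tf]] : exists f, [/\ f \in alpha, e != f & mdist t f < r].
  by have [eb|eb] := eqVneq e b; [exists c; rewrite eb|exists b].
have := ler_sum2 (F := fun a => cap r (mdist t a)) (fset_uniq alpha) ealpha falpha ef
  (fun=> cap_ge0 _ _).
rewrite -/(S t) => le2; have := cap_inside tf; have := optimal_excess Mt.
have : r ^+ 2 - m t <= cap r (mdist t e) by rewrite me /cap le_max lexx orbT.
by lra.
Qed.

Lemma optimal_separated b c : b \in alpha -> c \in alpha -> b != c ->
  2 * r <= mdist b c.
Proof.
move=> balpha calpha; apply: contraNT; rewrite -ltNge => bc.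
have [t [Mt tb tc]] := midpoint (alphaM balpha) (alphaM calpha).
by apply/eqP; apply: (optimal_disjoint Mt) => //; lra.
Qed.

(** A point of the cell is no farther from [c] than from its nearest codepoint, which is within [r]
    by covering. Conversely, within [r] of [c], separation by [2r] makes every other codepoint at
    least [r] away. *)
Lemma optimal_voronoi c : c \in alpha ->
  voronoi_cell M alpha c = [set t | M t /\ mdist t c <= r].
Proof.
move=> calpha; apply/seteqP; split=> t [Mt tc]; split => //.
  have [e ealpha me] := m_attained t.
  apply: le_trans (tc e ealpha) _.
  rewrite -(ler_pXn2r (n := 2)) ?nnegrE ?mdist_ge0 ?(ltW r_gt0)// -me.
  exact: optimal_covers.
move=> b balpha; have [->//|bc] := eqVneq b c.
have := optimal_separated balpha calpha bc; have := metric_triangle b t c.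
by rewrite (metric_sym b t); lra.
Qed.

End lower_bound.

Let distortion_ge alpha : codebook M n alpha ->
  ((r ^+ 2 / 3)%:E <= distortion M P alpha)%E.
Proof.
move=> [alphaM alpha0 alphan]; have [m [cm mle mex ->]] := distortion_min alpha0.
by rewrite lee_fin (lower_bound alphaM).
Qed.

(** Midpoints of the [n] consecutive tiles of length [2r] of [[p, q]], counted from [i = 0]. *)
Let center (i : 'I_n) : R := p + (2 * i%:R + 1) * r.

Let midpoints : {fset T} := [fset gamma (center i) | i : 'I_n]%fset.

Let center_bounds i : p <= center i - r /\ center i + r <= q.
Proof.
have i1 : (i%:R + 1) * r <= n%:R * r by rewrite ler_pM2r// natr1 ler_nat.
have i0 : 0 <= i%:R * r by rewrite mulr_ge0// ltW.
by rewrite /center LE; split; lra.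
Qed.

Let midpoints_codebook : codebook M n midpoints.
Proof.
split.
- move=> _ /imfsetP[i _ ->]; rewrite -gammaM; exists (center i) => //=.
  rewrite in_itv/=; have [pc cq] := center_bounds i.
  by rewrite (le_trans pc) ?(le_trans _ cq) ?lerDl ?gerBl ?ltW.
- rewrite cardfs_gt0; apply/fset0Pn; exists (gamma (center (Ordinal n_gt0))).
  exact: in_imfset.
- by rewrite (leq_trans (leq_imfset_card _ _ _))// -cardE card_ord.
Qed.

Let midpoints_cover x : `[p, q]%classic x -> exists i, `|x - center i| <= r.
Proof.
rewrite /= in_itv/= => /andP[px xq].
suff [k kn /andP[kx xk]] :
    exists2 k, (k < n)%N & p + 2 * k%:R * r <= x <= p + 2 * k.+1%:R * r.
  exists (Ordinal kn); move: xk; rewrite /center -natr1 ler_norml/= => xk.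
  by apply/andP; split; lra.
(* Induction on the number of tiles: [x] lies in the last tile or is covered by the earlier ones. *)
move: n_gt0 xq; rewrite LE; elim: (n) => // -[_ _ xq|k IH _ xq].
  by exists 0%N; rewrite // mulr0 mul0r addr0 px.
have [xk|kx] := leP x (p + 2 * k.+1%:R * r); last first.
  by exists k.+1; rewrite // xq ltW.
by have [j jk jx] := IH isT xk; exists j => //; exact: ltnW.
Qed.

Let cap_center_far x i j : `|x - center i| <= r -> i != j -> cap r (x - center j) = 0.
Proof.
move=> xi ij; apply/max_l; rewrite subr_le0 -[leRHS]real_normK ?num_real//.
rewrite ler_pXn2r ?nnegrE ?(ltW r_gt0)//.
have : 2 * r <= `|center i - center j|.
  have -> : center i - center j = 2 * r * (i%:R - j%:R) by rewrite /center; ring.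
  rewrite normrM (gtr0_norm (x := 2 * r)) ?mulr_gt0// ler_pMr ?mulr_gt0//.
  have [lij|lji|/val_inj eij] := ltngtP i j; last by rewrite eij eqxx in ij.
    by rewrite distrC ger0_norm ?subr_ge0 ?ler_nat ?(ltnW lij)// lerBrDr nat1r ler_nat.
  by rewrite ger0_norm ?subr_ge0 ?ler_nat ?(ltnW lji)// lerBrDr nat1r ler_nat.
have := ler_distD x (center i) (center j); rewrite (distrC (center i) x).
by have := r_gt0; lra.
Qed.

(** Caps are now taken on the parameter line. There [r^2 - U x] is the squared distance to the
    centre of the tile of [x], which bounds [m (gamma x)] since [gamma] is 1-Lipschitz; all caps fit
    in [[p, q]], so each has full mass. *)
Let midpoints_le : (distortion M P midpoints <= (r ^+ 2 / 3)%:E)%E.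
Proof.
have [_ alpha0 _] := midpoints_codebook.
have [m [cm mle mex ->]] := distortion_min alpha0.
rewrite lee_fin [leLHS]mulrC ler_pdivrMr//.
pose U x := \sum_(i : 'I_n) cap r (x - center i).
have [|cU IU] := @Rintegral_itv_sum R _ (index_enum 'I_n) (fun i x => cap r (x - center i)) p q.
  move=> i x; apply: (@continuous_comp _ _ _ (fun x => x - center i) (cap r)).
    by apply: cvgB => //; exact: cvg_cst.
  exact: cap_continuous.
have mU x : `[p, q]%classic x -> m (gamma x) <= r ^+ 2 - U x.
  move=> /midpoints_cover[i xi]; rewrite /U (bigD1 i)//= big1 ?addr0; last first.
    by move=> j ji; rewrite (cap_center_far xi)// eq_sym.
  have sq : (x - center i) ^+ 2 <= r ^+ 2.
    by rewrite -(real_normK (num_real _)) ler_pXn2r// nnegrE ltW.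
  rewrite /cap max_r ?subr_ge0// subKr.
  apply: le_trans (mle _ (gamma (center i)) _) _; first exact: in_imfset.
  rewrite -[leRHS]real_normK ?num_real//.
  by rewrite ler_pXn2r ?nnegrE ?mdist_ge0.
have {}IU : \int[mu]_(x in `[p, q]) U x = n%:R * (4 / 3 * r ^+ 3).
  rewrite IU (eq_bigr (fun=> 4 / 3 * r ^+ 3)); last first.
    move=> i _; apply/eqP; rewrite (Rintegral_cap_le (center i) r_gt0 (ltW pq)).2.
    by have [h1 h2] := center_bounds i; rewrite h1 h2.
  by rewrite sumr_const card_ord [RHS]mulr_natl.
have cmg : continuous (fun x => m (gamma x)).
  by move=> x; apply: (@continuous_comp _ _ _ gamma m); [exact: gamma_continuous|exact: cm].
apply: (@le_trans _ _ (\int[mu]_(x in `[p, q]) (r ^+ 2 - U x))).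
  apply: le_Rintegral => //; apply: continuous_integrable => //.
  by move=> x; apply: cvgB; [exact: cvg_cst|exact: cU].
rewrite RintegralB//; last 2 first.
- by apply: continuous_integrable => x; exact: cvg_cst.
- exact: continuous_integrable.
rewrite Rintegral_itv_cst ?(ltW pq)// IU qBp LE.
by rewrite le_eqVlt; apply/orP; left; apply/eqP; field.
Qed.

Lemma quantization_errorE : quantization_error M P n = (r ^+ 2 / 3)%:E.
Proof.
apply/eqP; rewrite eq_le; apply/andP; split.
  apply: ge_ereal_inf; exists (distortion M P midpoints); last exact: midpoints_le.
  by exists midpoints.
by apply: le_ereal_inf_tmp => _ [alpha calpha <-]; exact: distortion_ge.
Qed.

Lemma midpoints_optimal : optimal_means M P n midpoints.
Proof.
split=> //; apply/eqP; rewrite quantization_errorE eq_le midpoints_le/=.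
exact: distortion_ge.
Qed.

(** The cell is only known as a metric ball here; the full cap mass is kept so that the interval
    case can show that this ball is not cut off by an endpoint. *)
Lemma optimal_meansP alpha : optimal_means M P n alpha ->
  #|` alpha| = n /\ forall c, c \in alpha ->
    [/\ M c, voronoi_cell M alpha c = [set t | M t /\ mdist t c <= r]
    & \int[mu]_(x in `[p, q]) cap r (mdist (gamma x) c) = 4 / 3 * r ^+ 3].
Proof.
move=> [[alphaM alpha0 alphan]]; have [m [cm mle mex ->]] := distortion_min alpha0.
rewrite quantization_errorE => -[opt]; split; first exact: (optimal_card alphaM cm mex).
move=> c calpha; split; first exact: alphaM.
  exact: (optimal_voronoi alphaM cm mle mex).
exact: (optimal_cap alphaM cm mex).
Qed.

End codebooks.

(** * From image measures of the uniform law to Lebesgue integrals *)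

Lemma integral_distribution_uniform (R : realType) (T : pointedMetricType R)
    (a b : R) (ab : a < b) (X : {mfun measurableTypeR R >-> borel T})
    (M : set T) (f : T -> R) :
  continuous (X : R -> T) -> continuous f -> (forall t, 0 <= f t) ->
  measurable (M : set (borel T)) -> `[a, b] `<=` X @^-1` M ->
  (\int[distribution (uniform_prob ab) X]_(t in M) (f t)%:E =
   ((b - a)^-1 * \int[lebesgue_measure]_(x in `[a, b]) f (X x))%:E)%E.
Proof.
move=> cX cf f0 mM abM.
have mf : measurable_fun setT (EFin \o f : borel T -> \bar R).
  by apply/measurable_EFinP; exact: (@continuous_borel _ _ f cf).
have mX : measurable_fun setT X by [].
rewrite /distribution ge0_integral_pushforward//; last 2 first.
- exact: measurable_funTS mf.
- by move=> t _; rewrite lee_fin.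
rewrite integral_mkcond integral_uniform; last 2 first.
- apply/(measurable_restrictT _ _).1.
    by rewrite -[_ @^-1` _]setTI; exact: mX.
  by apply: measurable_funTS; exact: measurableT_comp mf mX.
- by move=> x; rewrite patchE; case: ifP => // _; rewrite lee_fin.
rewrite EFinM; congr (_ * _)%E.
rewrite (eq_integral (fun x => (f (X x))%:E)); last first.
  by move=> x; rewrite inE => /abM Mx; rewrite patchE mem_set.
rewrite /Rintegral fineK//; apply: integrable_fin_num => //.
apply: continuous_integrable => x.
by apply: (@continuous_comp _ _ _ (X : R -> T) f); [exact: cX|exact: cf].
Qed.

Lemma closed_borel (R : realType) (T : pointedMetricType R) (A : set T) :
  closed A -> measurable (A : set (borel T)).
Proof.
move=> cA; rewrite -[A]setCK; apply: measurableC; apply: sub_sigma_algebra.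
exact: closed_openC.
Qed.

Lemma ler_half_norm (R : realFieldType) (x y z : R) :
  x - y = z / 2 \/ x - y = - z / 2 -> `|x - y| <= `|z| / 2.
Proof. by case=> ->; rewrite normrM ?normrN (ger0_norm (x := 2^-1)). Qed.

Lemma arc_itv (R : realType) (c s : R) : arc_with_midpoint idfun (2 * s) `[c - s, c + s]%classic c.
Proof.
exists (c - s); split; last by rewrite /=; field.
by rewrite image_id (_ : c - s + 2 * s = c + s)//; ring.
Qed.

(** * The compact interval *)

Section interval.
Context {R : realType} (a : R) (L r : R) (n : nat).
Hypotheses (n_gt0 : (0 < n)%N) (r_gt0 : 0 < r) (LE : L = 2 * n%:R * r).
Variable ab : a < a + L.
Notation I := ([set` `[a, a + L]] : set R^o).
Notation mu := (@lebesgue_measure R).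

Let capE c x : cap r (mdist (x : R^o) c) = cap r (x - c).
Proof. by rewrite -cap_norm /mdist/= normr_id cap_norm -cap_norm distrC cap_norm. Qed.

Let lip (x y : R^o) : mdist (idfun x) (idfun y) <= `|x - y|.
Proof. by rewrite /mdist/= distrC. Qed.

Let integralP (f : R^o -> R) : continuous f -> (forall t, 0 <= f t) ->
  (\int[interval_uniform ab]_(t in I) (f t)%:E =
   (L^-1 * \int[mu]_(x in `[a, (a + L)%R]) f (idfun x))%:E)%E.
Proof.
move=> cf f0; rewrite /interval_uniform integral_distribution_uniform//.
- by rewrite [a + L - a]addrC addKr.
- by move=> x; exact: cvg_id.
- by apply: closed_borel; exact: itv_closed.
Qed.

Let Rintegral_cap_mdist (c : R^o) : I c ->
  \int[mu]_(x in `[a, a + L]) cap r (mdist (idfun x : R^o) c) <= 4 / 3 * r ^+ 3.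
Proof.
move=> _; under eq_Rintegral do rewrite capE.
exact: (Rintegral_cap_le c r_gt0 (ltW ab)).1.
Qed.

Let midpoint_itv (b c : R) : a <= b <= a + L -> a <= c <= a + L ->
  a <= (b + c) / 2 <= a + L.
Proof. by move=> /andP[? ?] /andP[? ?]; apply/andP; split; lra. Qed.

Let midpoint (b c : R^o) : I b -> I c -> exists t : R^o, [/\ I t,
  mdist t b <= mdist b c / 2 & mdist t c <= mdist b c / 2].
Proof.
rewrite /= !in_itv/= => bI cI; exists ((b + c) / 2 : R); split.
- by rewrite in_itv/=; exact: midpoint_itv.
- by apply: ler_half_norm; right; field.
- by apply: ler_half_norm; left; field.
Qed.

Let closed_ball_itv (c : R) : (a <= c - r) && (c + r <= a + L) ->
  [set t : R^o | I t /\ mdist t c <= r] = `[c - r, c + r]%classic.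
Proof.
have tcE (t : R) : (`|c - t| <= r) = (c - r <= t <= c + r).
  by rewrite ler_norml; apply/idP/idP; lra.
move=> /andP[ac ca]; apply/seteqP.
split=> t; rewrite /= !in_itv/= /mdist/= tcE; first by case.
by move=> /[dup] /andP[? ?] ->; rewrite (le_trans ac)// (le_trans _ ca).
Qed.

Lemma interval_quantization :
  [/\ exists alpha : {fset R^o}, optimal_means I (interval_uniform ab) n alpha,
      forall alpha : {fset R^o}, optimal_means I (interval_uniform ab) n alpha ->
        #|` alpha| = n /\ forall c, c \in alpha ->
          arc_with_midpoint idfun (2 * r) (voronoi_cell I alpha c) c
    & quantization_error I (interval_uniform ab) n = (r ^+ 2 / 3)%:E].
Proof.
have IM : idfun @` `[a, a + L] = I by rewrite image_id.
split.
- eexists; exact: (midpoints_optimal n_gt0 r_gt0 LE lip IM integralP Rintegral_cap_mdist).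
- move=> alpha /(optimal_meansP n_gt0 r_gt0 LE lip IM integralP Rintegral_cap_mdist midpoint).
  move=> [-> h]; split => // c /h[Ic -> Icap].
  (* Full cap mass is the equality case of [Rintegral_cap_le]: the ball around [c] does not stick
     out of the interval. *)
  have : (a <= c - r) && (c + r <= a + L).
    rewrite -(Rintegral_cap_le c r_gt0 (ltW ab)).2 -Icap; apply/eqP.
    by apply: eq_Rintegral => x _; rewrite capE.
  by move=> /closed_ball_itv ->; exact: arc_itv.
- exact: (quantization_errorE n_gt0 r_gt0 LE lip IM integralP Rintegral_cap_mdist).
Qed.

End interval.

(** * Distances, midpoints and balls on the circle *)

Section circle_geometry.
Context {R : realType} (L : {posnum R}).
Notation l := L%:num.
Notation proj := (circle_proj L).

Lemma circle_projDz x (k : int) : proj (x + k%:~R * l) = proj x.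
Proof. by apply/circle_proj_eq; exists k; rewrite addrC addKr. Qed.

Lemma circle_proj_surj (s : circle L) : exists2 x, 0 <= x < l & proj x = s.
Proof.
exists (repr s + (- Num.floor (repr s / l))%:~R * l); last first.
  by rewrite circle_projDz reprKcircle.
have := floor_itv (repr s / l); rewrite ler_pdivlMr// ltr_pdivrMr//.
rewrite intrN intrD mulrDl mul1r mulNr; move: (_%:~R * l) => z /andP[? ?].
by apply/andP; split; lra.
Qed.

Lemma circle_dist_attained x y : exists2 k : int,
  mdist (proj x) (proj y) = `|x - y + k%:~R * l| & `|x - y + k%:~R * l| <= l / 2.
Proof.
pose d := x - y.
have [k] : exists k : int, `|d + k%:~R * l| <= l / 2.
  (* Rounding [d / l] to a nearest integer leaves a remainder of at most half a turn. *)
  exists (- Num.floor (d / l + 2^-1)).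
  have := floor_itv (d / l + 2^-1); rewrite intrN intrD.
  move: (_%:~R) => z; rewrite -lerBlDr -ltrBrDr ler_pdivlMr// ltr_pdivrMr//.
  rewrite !mulrBl mulrDl mul1r mulrC => /andP[? ?].
  by rewrite ler_norml; apply/andP; split; lra.
move=> kd; exists k => //; apply/eqP; rewrite eq_le; apply/andP; split.
  rewrite -(circle_projDz x k); apply: le_trans (circle_proj_dist _ _ _) _.
  by rewrite addrAC.
rewrite [leRHS]circle_distE; apply: lb_le_inf => [|_ [m _ <-]].
  by exists `|x - y + 0%:~R * l|; exists 0.
rewrite -/d; have [->//|mk] := eqVneq m k.
(* Two distinct lifts differ by at least [l], so when one has absolute value at most [l / 2], the
   other has at least [l / 2]. *)
have : l <= `|(m - k)%:~R * l|.
  rewrite normrM (gtr0_norm (x := l))// ler_pMl// -intr_norm ler1z.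
  by move: mk; rewrite -subr_eq0 -normr_gt0; lia.
have -> : (m - k)%:~R * l = (d + m%:~R * l) - (d + k%:~R * l) by rewrite intrB; ring.
by have := ler_normB (d + m%:~R * l) (d + k%:~R * l); lra.
Qed.

(** Lift [b] to the representative closest to that of [c]; the midpoint on the line projects to the
    one wanted. *)
Lemma circle_midpoint (b c : circle L) : exists t : circle L,
  mdist t b <= mdist b c / 2 /\ mdist t c <= mdist b c / 2.
Proof.
rewrite -(reprKcircle b) -(reprKcircle c); set y := repr b; set x := repr c.
have [k -> _] := circle_dist_attained y x.
exists (proj ((x + y + k%:~R * l) / 2)); rewrite -(circle_projDz y k).
split; apply: le_trans (circle_proj_dist _ _ _) _; apply: ler_half_norm.
  by right; field.
by left; field.
Qed.

Lemma circle_closed_ball x r : [set t | mdist t (proj x) <= r] =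
  proj @` `[x - r, x + r].
Proof.
apply/seteqP; split=> [t /=|_ [y /= + <-]].
  rewrite -(reprKcircle t); have [k -> _] := circle_dist_attained (repr t) x.
  rewrite ler_norml => /andP[? ?]; exists (repr t + k%:~R * l); last exact: circle_projDz.
  by rewrite /= in_itv/=; apply/andP; split; lra.
rewrite in_itv/= => /andP[? ?]; apply: le_trans (circle_proj_dist _ _ _) _.
by rewrite ler_norml; apply/andP; split; lra.
Qed.

End circle_geometry.

(** * Quantization of the circle *)

Section circle.
Context {R : realType} (L : {posnum R}) (r : R) (n : nat).
Notation l := L%:num.
Notation proj := (circle_proj L).
Notation mu := (@lebesgue_measure R).
Hypotheses (n_gt0 : (0 < n)%N) (r_gt0 : 0 < r) (LE : l = 2 * n%:R * r).

(** The endpoint [0 + l] is the [p + L] of the general argument at [p = 0]. *)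
Let projT : proj @` `[0, 0 + l] = [set: circle L].
Proof.
apply/seteqP; split=> // s _; have [x /andP[x0 xl] <-] := circle_proj_surj s.
by exists x; rewrite //= in_itv/= x0 add0r ltW.
Qed.

Let integralP (f : circle L -> R) : continuous f -> (forall t, 0 <= f t) ->
  (\int[circle_uniform L]_(t in setT) (f t)%:E =
   (l^-1 * \int[mu]_(x in `[0%R, (0 + l)%R]) f (proj x))%:E)%E.
Proof.
move=> cf f0; rewrite /circle_uniform integral_distribution_uniform//.
- by rewrite subr0 add0r.
- exact: circle_proj_continuous.
Qed.

Let Rintegral_cap_mdist (c : circle L) : setT c ->
  \int[mu]_(x in `[0, 0 + l]) cap r (mdist (proj x) c) <= 4 / 3 * r ^+ 3.
Proof.
move=> _; rewrite add0r; have [c' /andP[c0 cl] <-] := circle_proj_surj c.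
(* As [r <= l / 2], only the lifts [c' - l], [c'] and [c' + l] of [c] lie within
   [r] of [[0, l]]; the three integrals telescope. *)
pose U x := cap r (x - (c' - l)) + cap r (x - c') + cap r (x - (c' + l)).
have ccap d : continuous (fun x => cap r (x - d)).
  move=> x; apply: (@continuous_comp _ _ _ (fun x => x - d) (cap r)).
    by apply: cvgB => //; exact: cvg_cst.
  exact: cap_continuous.
have cU : continuous U by move=> x; do 2?apply: cvgD; exact: ccap.
apply: (@le_trans _ _ (\int[mu]_(x in `[0, l]) U x)).
  apply: le_Rintegral => //; [|exact: continuous_integrable|].
    apply: continuous_integrable.
    move=> x; apply: (@continuous_comp _ _ _ (fun x => mdist (proj x) (proj c') : R^o) (cap r)).
      apply: (@continuous_comp _ _ _ proj (mdist ^~ (proj c') : circle L -> R^o)).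
        exact: circle_proj_continuous.
      exact: mdist_continuous.
    exact: cap_continuous.
  move=> x; rewrite /= in_itv/= => /andP[x0 xl].
  have [k -> kl] := circle_dist_attained L x c'; rewrite cap_norm /U.
  have [? ? ?] : [/\ 0 <= cap r (x - (c' - l)), 0 <= cap r (x - c') &
    0 <= cap r (x - (c' + l))] by split; exact: cap_ge0.
  have l0 : 0 < l by [].
  (* Since [|x - c'| <= l] and the chosen lift is within [l / 2], [|k| l] is at most [3/2 l]. *)
  have [k1 k2] : (- 1 - 1 < k) /\ (k < 1 + 1).
    move: kl; rewrite ler_norml => /andP[? ?].
    by split; rewrite -(ltr_int R) -(ltr_pM2r l0) !(intrD, intrN) mulr1z; lra.
  have [->|[->|->]] : k = -1 \/ k = 0 \/ k = 1 by lia.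
  - have -> : x - c' + (-1)%:~R * l = x - (c' + l) by rewrite intrN; ring.
    lra.
  - by rewrite mul0r addr0; lra.
  - have -> : x - c' + 1%:~R * l = x - (c' - l) by ring.
    lra.
rewrite RintegralD//; [|apply: continuous_integrable..]; last 2 first.
- by move=> x; apply: cvgD; exact: ccap.
- exact: ccap.
rewrite RintegralD//; try exact/continuous_integrable/ccap.
rewrite !Rintegral_cap //.
have -> : 0 - (c' - l) = l - c' by ring.
have -> : l - (c' + l) = 0 - c' by ring.
have -> : 0 - (c' + l) = - (c' + l) by ring.
rewrite cap_primN//.
(* Only [cap_prim] at [2l - c'] and at [c' + l] survive, each at most [2/3 r^3]. *)
have := (cap_prim_le (l - (c' - l)) r_gt0).1; have := (cap_prim_le (c' + l) r_gt0).1.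
by lra.
Qed.

Lemma circle_quantization :
  [/\ exists alpha : {fset circle L},
        optimal_means [set: circle L] (circle_uniform L) n alpha,
      forall alpha : {fset circle L},
        optimal_means [set: circle L] (circle_uniform L) n alpha ->
        #|` alpha| = n /\ forall c, c \in alpha ->
          arc_with_midpoint proj (2 * r) (voronoi_cell [set: circle L] alpha c) c
    & quantization_error [set: circle L] (circle_uniform L) n = (r ^+ 2 / 3)%:E].
Proof.
have lip : forall x y, mdist (proj x) (proj y) <= `|x - y| := circle_proj_dist L.
split.
- eexists; exact: (midpoints_optimal n_gt0 r_gt0 LE lip projT integralP Rintegral_cap_mdist).
- move=> alpha /(optimal_meansP n_gt0 r_gt0 LE lip projT integralP Rintegral_cap_mdist).
  case=> [b c _ _|-> h]; first by have [t [? ?]] := circle_midpoint b c; exists t.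
  split => // c /h[_ -> _]; have [x _ <-] := circle_proj_surj c.
  (* The closed ball of radius [r] is the arc starting [r] before [x]; for [n = 1] it is the whole
     circle, cut opposite to the codepoint. *)
  exists (x - r); split; last by congr proj; field.
  rewrite (_ : x - r + 2 * r = x + r); last by ring.
  by rewrite -circle_closed_ball; apply/seteqP; split=> t //= [].
- exact: (quantization_errorE n_gt0 r_gt0 LE lip projT integralP Rintegral_cap_mdist).
Qed.

End circle.

Theorem proposition7p1p1 (R : realType) (L : {posnum R}) (n : nat)
    (n_ge1 : (1 <= n)%N) :
  (* the circle of length L *)
  ([/\ exists alpha : {fset circle L},
        optimal_means [set: circle L] (circle_uniform L) n alpha,
      forall alpha : {fset circle L},
        optimal_means [set: circle L] (circle_uniform L) n alpha ->
        #|` alpha| = n /\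
        forall c, c \in alpha ->
          arc_with_midpoint (circle_proj L) (L%:num / n%:R)
            (voronoi_cell [set: circle L] alpha c) c
    & quantization_error [set: circle L] (circle_uniform L) n =
        (L%:num ^+ 2 / (12 * n%:R ^+ 2))%:E])
  /\
  (* the compact intervals of length L *)
  (forall (a b : R) (ab : a < b), b - a = L%:num ->
    [/\ exists alpha : {fset R^o},
        optimal_means (`[a, b] : set R^o) (interval_uniform ab) n alpha,
      forall alpha : {fset R^o},
        optimal_means (`[a, b] : set R^o) (interval_uniform ab) n alpha ->
        #|` alpha| = n /\
        forall c, c \in alpha ->
          arc_with_midpoint idfun (L%:num / n%:R)
            (voronoi_cell (`[a, b] : set R^o) alpha c) c
    & quantization_error (`[a, b] : set R^o) (interval_uniform ab) n =
        (L%:num ^+ 2 / (12 * n%:R ^+ 2))%:E]).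
Proof.
have n0 : n%:R != 0 :> R by rewrite pnatr_eq0 -lt0n.
(* Half the length of a cell. *)
pose r := L%:num / (2 * n%:R).
have r_gt0 : 0 < r by rewrite divr_gt0// mulr_gt0// ltr0n.
have LE : L%:num = 2 * n%:R * r by rewrite mulrC divfK// mulf_neq0.
have -> : L%:num / n%:R = 2 * r by rewrite /r; field.
have -> : L%:num ^+ 2 / (12 * n%:R ^+ 2) = r ^+ 2 / 3 by rewrite /r; field.
split; first exact: circle_quantization.
(* The measure depends on the proof [ab], so [b] is replaced throughout by [a + L]. *)
move=> a b ab /eqP; rewrite subr_eq addrC => /eqP bE; subst b.
exact: interval_quantization.
Qed.
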